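(* Let $\mathcal{G}$ be a directed (possibly weighted) graph on the vertex set $\{1,\ldots,n\}$, $n\ge 2$, with nonnegative weighted adjacency matrix $A$, all of whose row sums and column sums are positive. Let $p(x,y;\mathcal{G})$, $p(x;X)$, $p(y;Y)$, $Q(\cdot;X)$, $Q(\cdot;Y)$, $T_j(\cdot;X)$, $T_k(\cdot;Y)$, $S_j(\cdot;X)$, $S_k(\cdot;Y)$ and $\mathrm{LP}[j,k;\mathcal{G}]$ be as defined in the context. Let $\mathscr{C}(\cdot,\cdot;\mathcal{G}):[0,1]^2\to[0,\infty)$ be the square integrable function $$\mathscr{C}(u,v;\mathcal{G})=\frac{p\big(Q(u;X),Q(v;Y);\mathcal{G}\big)}{p\big(Q(u;X);X\big)\,p\big(Q(v;Y);Y\big)} .$$ Then for all $j,k\in\{1,\ldots,n-1\}$, $$\mathrm{LP}[j,k;\mathcal{G}]=\sum_{x=1}^n\sum_{y=1}^n p(x,y;\mathcal{G})\,T_j(x;X)\,T_k(y;Y)=\int_0^1 S_j(u;X)\left(\int_0^1 \mathscr{C}(u,v;\mathcal{G})\,S_k(v;Y)\,dv\right)du .$$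
   Context: Let $A=(A(x,y))_{x,y=1}^n$ be the (weighted, entrywise nonnegative) adjacency matrix of $\mathcal{G}$, and $N=\sum_{x,y=1}^n A(x,y)$. Define $$p(x,y;\mathcal{G})=A(x,y)/N,\qquad p(x;X)=\sum_{y=1}^n A(x,y)/N,\qquad p(y;Y)=\sum_{x=1}^n A(x,y)/N.$$ Thus $(X,Y)$ is a pair of random variables with values in $\{1,\ldots,n\}$, with joint probability mass function $p(\cdot,\cdot;\mathcal{G})$ and marginals $p(\cdot;X)$, $p(\cdot;Y)$. For $Z\in\{X,Y\}$: $F(z;Z)=\Pr[Z\le z]$ is the distribution function; $Q(u;Z)=\inf\{z\in\{1,\ldots,n\}: F(z;Z)\ge u\}$, $0\le u\le 1$, is the quantile function (so $Q(0;Z)=1$ by convention); and $F^{\mathrm{mid}}(z;Z)=F(z;Z)-\tfrac12 p(z;Z)$ is the mid-distribution function. Put $$T_1(z;Z)=\frac{\sqrt{12}\,\big[F^{\mathrm{mid}}(z;Z)-\tfrac12\big]}{\sqrt{1-\sum_{z'=1}^n p(z';Z)^3}} .$$ The functions $T_1(\cdot;Z),T_2(\cdot;Z),\ldots,T_{n-1}(\cdot;Z)$ on $\{1,\ldots,n\}$ are obtained by Gram–Schmidt orthonormalization of $1,T_1,T_1^2,\ldots,T_1^{n-1}$ (discarding the constant function) with respect to the inner product $\langle f,g\rangle=\sum_z f(z)g(z)p(z;Z)$. Hence $\sum_z T_j(z;Z)p(z;Z)=0$, $\sum_z T_j(z;Z)^2p(z;Z)=1$, and $\sum_z T_j(z;Z)T_k(z;Z)p(z;Z)=0$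 for $j\ne k$. The LP graph basis functions on the unit interval are $S_j(u;Z)=T_j(Q(u;Z);Z)$. The LP graph transform is $\mathrm{LP}[j,k;\mathcal{G}]=\mathbb{E}[T_j(X;X)\,T_k(Y;Y)]$ (evaluation of the $j$th basis function of $X$ at $X$ and of the $k$th basis function of $Y$ at $Y$), the expectation being under the joint mass function $p(\cdot,\cdot;\mathcal{G})$. *)

(* Defs.v *)
From HB Require Import structures.
From mathcomp Require Import all_boot all_order all_algebra.
From mathcomp Require Import all_classical all_reals all_analysis.

Set Implicit Arguments.
Unset Strict Implicit.
Unset Printing Implicit Defensive.

Import Order.TTheory GRing.Theory Num.Theory.
Import numFieldNormedType.Exports.

Local Open Scope classical_set_scope.
Local Open Scope ring_scope.

(* The vertex set {1, ..., m} is 'I_m, with m = n.+1, shifted down by one: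
   vertex z is the ordinal of value z - 1. It carries the discrete
   sigma-algebra, so that {RV P >-> 'I_n.+1} is available. *)
HB.instance Definition _ (n : nat) := isPointed.Build 'I_n.+1 ord0.
HB.instance Definition _ (n : nat) :=
  @isMeasurable.Build default_measure_display 'I_n.+1
    (@discrete_measurable 'I_n.+1) (@discrete_measurable0 'I_n.+1)
    (@discrete_measurableC 'I_n.+1) (@discrete_measurableU 'I_n.+1).

Section graph_pmf.
Context {R : realType} {n : nat}.
Variable A : 'M[R]_n.+1.

Definition total_weight : R := \sum_x \sum_y A x y.

Definition joint_pmf (x y : 'I_n.+1) : R := A x y / total_weight.

Definition pmf_X (x : 'I_n.+1) : R := \sum_y A x y / total_weight.

Definition pmf_Y (y : 'I_n.+1) : R := \sum_x A x y / total_weight.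

End graph_pmf.

Definition distr_fun {R : realType} {n : nat} {d : measure_display}
    {Omega : measurableType d} (P : probability Omega R)
    (Z : Omega -> 'I_n.+1) (z : 'I_n.+1) : R :=
  fine (P [set w | (Z w <= z)%N]).

(* [p] is the mass function of Z and [F] its distribution function. *)
Section LP_basis.
Context {R : realType} {n : nat}.
Variables (p F : 'I_n.+1 -> R).

(* For u <= 1 the set of z with u <= F z contains ord_max, so its infimum is
   attained; in particular quantile 0 = ord0. *)
Definition quantile (u : R) : 'I_n.+1 :=
  [arg min_(z < ord_max | (u <= F z)%R) (z : nat)]%N.

Definition Fmid (z : 'I_n.+1) : R := F z - p z / 2.

Definition T1 (z : 'I_n.+1) : R :=
  Num.sqrt 12 * (Fmid z - 1 / 2) / Num.sqrt (1 - \sum_z' p z' ^+ 3).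

Definition inner (f g : 'I_n.+1 -> R) : R := \sum_z f z * g z * p z.

Definition orthonormalize (s : seq ('I_n.+1 -> R)) (f : 'I_n.+1 -> R) :
    'I_n.+1 -> R :=
  let r z := f z - \sum_(e <- s) inner f e * e z in
  fun z => r z / Num.sqrt (inner r r).

Fixpoint gram_schmidt (f : nat -> 'I_n.+1 -> R) (m : nat) :
    seq ('I_n.+1 -> R) :=
  if m is m'.+1 then
    let s := gram_schmidt f m' in rcons s (orthonormalize s (f m'))
  else [::].

(* Element number j (counted from 0) of the orthonormalization of
   1, T1, ..., T1 ^ n. Number 0 is the discarded constant; number 1 is T1
   itself, which is centred with unit variance when p is a positive mass
   function and n > 0. *)
Definition LPT (j : nat) : 'I_n.+1 -> R :=
  nth (fun=> 0) (gram_schmidt (fun k z => T1 z ^+ k) n.+1) j.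

Definition LPS (j : nat) (u : R) : R := LPT j (quantile u).

End LP_basis.

Section LP_transform.
Context {R : realType} {n : nat} {d : measure_display}
  {Omega : measurableType d}.
Variables (A : 'M[R]_n.+1) (P : probability Omega R) (X Y : Omega -> 'I_n.+1).

Definition T_X (j : nat) : 'I_n.+1 -> R := LPT (pmf_X A) (distr_fun P X) j.
Definition T_Y (k : nat) : 'I_n.+1 -> R := LPT (pmf_Y A) (distr_fun P Y) k.

Definition S_X (j : nat) : R -> R := LPS (pmf_X A) (distr_fun P X) j.
Definition S_Y (k : nat) : R -> R := LPS (pmf_Y A) (distr_fun P Y) k.

Definition LP (j k : nat) : \bar R :=
  'E_P[(fun w => T_X j (X w) * T_Y k (Y w))].

Definition graph_copula (u v : R) : R :=
  let x := quantile (distr_fun P X) u in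
  let y := quantile (distr_fun P Y) v in
  joint_pmf A x y / (pmf_X A x * pmf_Y A y).

End LP_transform.

(* Main.v *)
(* The quantile function of Z cuts [0, 1] into cells, one per vertex z, of length
   p(z; Z).  Integrals of step functions g(Q(u; Z)) are therefore the finite sums
   of g(z) p(z; Z), and in the double integral the weights p(x; X) p(y; Y) cancel
   the denominator of the copula density.  The form of the basis functions T_j
   plays no role. *)
Require Import Defs.
From HB Require Import structures.
From mathcomp Require Import all_boot all_order all_algebra.
From mathcomp Require Import all_classical all_reals all_analysis.
From mathcomp Require Import measurable_realfun ring.

Set Implicit Arguments.
Unset Strict Implicit.
Unset Printing Implicit Defensive.

Import Order.TTheory GRing.Theory Num.Theory.
Import numFieldNormedType.Exports.

Local Open Scope classical_set_scope.
Local Open Scope ring_scope.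

(** * Integrals of functions that factor through a finite type *)

Section finite_range.
Context {R : realType} {d : measure_display} {T : measurableType d}.
Context {J : finType}.
Variables (mu : {measure set T -> \bar R}) (D : set T) (q : T -> J).

Let cell (z : J) : set T := D `&` q @^-1` [set z].

Hypothesis mcell : forall z, measurable (cell z).

Lemma domain_cells : D = \big[setU/set0]_(z <- index_enum J) cell z.
Proof.
rewrite -bigcup_seq; apply/seteqP; split=> [t Dt|t [z _ []]//].
by exists (q t) => //=; rewrite mem_index_enum.
Qed.

Lemma measurable_finite_domain : measurable D.
Proof. by rewrite domain_cells; exact: bigsetU_measurable. Qed.

(** The preimage of [B] is the finite union of the cells whose value under [g] lies in [B], so [J]
    carries no sigma-algebra. *)
Lemma measurable_fun_finite_range (g : J -> R) :
  measurable_fun D (fun t => g (q t)).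
Proof.
move=> _ B _; rewrite [X in measurable X](_ : _ =
    \big[setU/set0]_(z <- index_enum J | `[< B (g z) >]) cell z); last first.
  rewrite -bigcup_seq_cond; apply/seteqP; split=> [t [Dt Bt]|t [z /= /andP[_]]].
    by exists (q t) => //=; rewrite mem_index_enum; exact/asboolP.
  by move=> /asboolP Bz [Dt qt]; split=> //; rewrite /preimage/= qt.
by apply: bigsetU_measurable.
Qed.

Lemma integrable_finite_range (g : J -> R) :
  (mu D < +oo)%E -> mu.-integrable D (fun t => (g (q t))%:E).
Proof.
move=> muD; apply: (@measurable_bounded_integrable _ _ _ mu (fun t => g (q t))).
- exact: measurable_finite_domain.
- exact: muD.
- exact: (measurable_fun_finite_range g).
(* The sum of all [|g z|] dominates each of them; unlike a maximum it makes sense for empty [J]. *)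
exists (\sum_z `|g z|); split; first exact: num_real.
move=> M /ltW leM t _ /=; apply: le_trans leM.
by rewrite (bigD1 (q t))//= lerDl sumr_ge0.
Qed.

(** The cells partition [D] and the integrand is constant on each. *)
Lemma integral_finite_range (g m : J -> R) :
  (forall z, mu (cell z) = (m z)%:E) ->
  (\int[mu]_(t in D) (g (q t))%:E = (\sum_z g z * m z)%:E)%E.
Proof.
move=> mum; rewrite {1}domain_cells integral_bigsetU_EFin//; last 3 first.
- exact: index_enum_uniq.
- by move=> i j _ _ [t [[_ <-] [_ <-]]].
- by rewrite -domain_cells; apply/measurable_EFinP; exact: measurable_fun_finite_range.
rewrite -sumEFin; apply: eq_bigr => z _.
rewrite (eq_integral (cst (g z)%:E)).
  by rewrite integral_cst// mum EFinM.
by move=> t /set_mem[_ /= ->].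
Qed.

End finite_range.

(** * Lengths of the cells of a quantile function *)

Section quantile_cells.
Context {R : realType} {n : nat}.
Variables (p F : 'I_n.+1 -> R).
Hypothesis p_ge0 : forall z, 0 <= p z.
Hypothesis p_sum1 : \sum_z p z = 1.
Hypothesis F_sum : forall z, F z = \sum_(z' : 'I_n.+1 | (z' <= z)%N) p z'.

Let I : set R := `[0, 1]%classic.
(** This is F(z-1); the strict sum avoids a predecessor and gives 0 at the first vertex. *)
Let lower (z : 'I_n.+1) : R := \sum_(z' : 'I_n.+1 | (z' < z)%N) p z'.

Let lower_ge0 z : 0 <= lower z.
Proof. by apply: sumr_ge0 => i _. Qed.

Let F_lower z : F z = lower z + p z.
Proof.
rewrite F_sum (bigD1 z)//= addrC; congr (_ + _).
by apply: eq_bigl => i; rewrite ltn_neqAle andbC.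
Qed.

Let F_le1 z : F z <= 1.
Proof.
rewrite F_sum -p_sum1 [leRHS](bigID (fun z' : 'I_n.+1 => (z' <= z)%N))/=.
by rewrite lerDl sumr_ge0.
Qed.

Let F_le_lower (i z : 'I_n.+1) : (i < z)%N -> F i <= lower z.
Proof.
move=> iz; rewrite F_sum /lower.
rewrite [leRHS](bigID (fun z' : 'I_n.+1 => (z' <= i)%N))/=.
rewrite (eq_bigl (fun j : 'I_n.+1 => (j < z)%N && (j <= i)%N)) ?lerDl ?sumr_ge0//.
by move=> j /=; case: (leqP j i) => ji; rewrite ?andbF// (leq_ltn_trans ji iz).
Qed.

Let F_max : F ord_max = 1.
Proof. by rewrite F_sum -p_sum1; apply: eq_bigl => i; rewrite -ltnS ltn_ord. Qed.

(* The quantile function takes the value z exactly on ]F(z-1), F(z)], whose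
   left end is closed when z is the first vertex because Q(0) = 1. *)
Let quantile_cell z : I `&` quantile F @^-1` [set z] =
  [set` Interval (BSide (z == ord0) (lower z)) (BRight (F z))].
Proof.
apply/seteqP; split=> u /=; rewrite /I/= !in_itv/=.
  move=> [/andP[u0 u1]]; rewrite /quantile.
  case: arg_minnP => [|i /= ui imin <-]; first by rewrite F_max.
  rewrite ui andbT; case: eqVneq => [->|i0] /=.
    by rewrite /lower big_pred0.
  (* If [u <= lower i], the predecessor of [i], where [F] equals [lower i], would also satisfy the
     constraint, against minimality of [i]. *)
  rewrite ltNge; apply/negP => ul.
  have i_gt0 : (0 < i)%N by rewrite lt0n.
  have i'n : (i.-1 < n.+1)%N by rewrite (leq_ltn_trans (leq_pred _)).
  have /imin /= : u <= F (Ordinal i'n).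
    apply: (le_trans ul); rewrite F_sum /lower le_eqVlt; apply/orP; left.
    by apply/eqP/eq_bigl => j /=; rewrite -[in LHS](prednK i_gt0) ltnS.
  by rewrite leqNgt prednK// leqnn.
move=> /andP[lu uF].
have u0 : 0 <= u.
  by apply: (le_trans (lower_ge0 z)); move: lu; case: eqP => _ //= /ltW.
split; first by rewrite u0 (le_trans uF).
rewrite /quantile.
case: arg_minnP => [|i /= ui /(_ z uF)]; first by rewrite F_max (le_trans uF).
(* The minimizer [i] is at most [z]. Were it smaller, then [u <= F i <= lower z], against the left
   end of the cell; for [z = ord0] no smaller vertex exists. *)
rewrite leq_eqVlt => /orP[/eqP iz|iz]; first exact/val_inj.
move: lu; case: eqVneq => [z0|_] /=; first by move: iz; rewrite z0.
by rewrite ltNge (le_trans ui)// F_le_lower.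
Qed.

Lemma measurable_quantile_cell z :
  measurable (I `&` quantile F @^-1` [set z]).
Proof. by rewrite quantile_cell; exact: measurable_itv. Qed.

Lemma lebesgue_measure_quantile_cell z :
  lebesgue_measure (I `&` quantile F @^-1` [set z]) = (p z)%:E.
Proof.
rewrite quantile_cell lebesgue_measure_itv/= lte_fin F_lower ltrDl.
case: ltP => [_|pz]; first by rewrite -EFinB addrC addKr.
(* Here [p z <= 0], hence [p z = 0]: the cell is empty or, at the first vertex, a single point. *)
by congr EFin; apply/le_anti; rewrite p_ge0.
Qed.

(** Quantile transform: for [u] uniform on [[0, 1]], [quantile F u] has mass function [p]. *)
Lemma integral_quantile (g : 'I_n.+1 -> R) :
  (\int[@lebesgue_measure R]_(u in I) (g (quantile F u))%:E =
   (\sum_z g z * p z)%:E)%E.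
Proof.
apply: (integral_finite_range (mu := lebesgue_measure)
  measurable_quantile_cell).
exact: lebesgue_measure_quantile_cell.
Qed.

End quantile_cells.

(** * Expectations and distribution functions from the joint law *)

Section joint_law.
Context {R : realType} {n : nat} {d : measure_display}
  {Omega : measurableType d}.
Variables (A : 'M[R]_n.+1) (P : probability Omega R).
Variables X Y : {RV P >-> 'I_n.+1}.
Hypothesis XY_joint : forall x y,
  P [set w | X w = x /\ Y w = y] = (joint_pmf A x y)%:E.

Let measurable_fiber (Z : {RV P >-> 'I_n.+1}) (B : set 'I_n.+1) :
  measurable (Z @^-1` B).
Proof. by rewrite -[X in measurable X]setTI; exact: measurable_funP. Qed.

Let pair_fiber (z : 'I_n.+1 * 'I_n.+1) :
  setT `&` (fun w => (X w, Y w)) @^-1` [set z] =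
  [set w | X w = z.1 /\ Y w = z.2].
Proof.
rewrite setTI; case: z => x y; apply/seteqP.
by split=> w /= => [[<- <-]|[-> ->]].
Qed.

Let measurable_pair_fiber z :
  measurable (setT `&` (fun w => (X w, Y w)) @^-1` [set z]).
Proof.
rewrite pair_fiber.
exact: (measurableI _ _
  (measurable_fiber X [set z.1]) (measurable_fiber Y [set z.2])).
Qed.

Lemma integral_joint (h : 'I_n.+1 -> 'I_n.+1 -> R) :
  (\int[P]_w (h (X w) (Y w))%:E =
   (\sum_x \sum_y h x y * joint_pmf A x y)%:E)%E.
Proof.
rewrite (integral_finite_range measurable_pair_fiber
  (fun z => h z.1 z.2) (m := fun z => joint_pmf A z.1 z.2)).
  by rewrite pair_big.
by move=> z; rewrite pair_fiber; exact: XY_joint.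
Qed.

(** The probability is the expectation of an indicator in [x] alone; summing the joint mass over [y]
    leaves the marginal. *)
Lemma distr_fun_X z :
  distr_fun P X z = \sum_(x : 'I_n.+1 | (x <= z)%N) pmf_X A x.
Proof.
have := integral_joint (fun x _ => \1_[set x' : 'I_n.+1 | (x' <= z)%N] x).
rewrite (eq_integral (fun w => (\1_[set w | (X w <= z)%N] w)%:E))//.
rewrite integral_indic//; last exact: (measurable_fiber X [set x | (x <= z)%N]).
rewrite setIT /distr_fun => ->/=; rewrite [RHS]big_mkcond/=.
apply: eq_bigr => x _; rewrite -mulr_sumr indicE.
have -> : (x \in [set x' : 'I_n.+1 | (x' <= z)%N]) = (x <= z)%N.
  exact: asboolb.
by case: ifP => _; rewrite ?mul1r ?mul0r.
Qed.

Lemma distr_fun_Y z :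
  distr_fun P Y z = \sum_(y : 'I_n.+1 | (y <= z)%N) pmf_Y A y.
Proof.
have := integral_joint (fun _ y => \1_[set y' : 'I_n.+1 | (y' <= z)%N] y).
rewrite (eq_integral (fun w => (\1_[set w | (Y w <= z)%N] w)%:E))//.
rewrite integral_indic//; last exact: (measurable_fiber Y [set x | (x <= z)%N]).
rewrite setIT /distr_fun => ->/=; rewrite [RHS]big_mkcond/= exchange_big/=.
apply: eq_bigr => y _; rewrite -mulr_sumr indicE.
have -> : (y \in [set y' : 'I_n.+1 | (y' <= z)%N]) = (y <= z)%N.
  exact: asboolb.
by case: ifP => _; rewrite ?mul1r ?mul0r.
Qed.

End joint_law.

(** * Positivity and normalization of the marginals *)

Section marginals.
Context {R : realType} {n : nat}.
Variable A : 'M[R]_n.+1.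
Hypothesis row_gt0 : forall x, 0 < \sum_y A x y.
Hypothesis col_gt0 : forall y, 0 < \sum_x A x y.

Lemma total_weight_gt0 : 0 < total_weight A.
Proof.
rewrite /total_weight (bigD1 ord0)//= ltr_pwDl// sumr_ge0// => x _.
exact: ltW.
Qed.

Lemma pmf_X_gt0 x : 0 < pmf_X A x.
Proof. by rewrite /pmf_X -mulr_suml divr_gt0// total_weight_gt0. Qed.

Lemma pmf_Y_gt0 y : 0 < pmf_Y A y.
Proof. by rewrite /pmf_Y -mulr_suml divr_gt0// total_weight_gt0. Qed.

Lemma pmf_X_sum1 : \sum_x pmf_X A x = 1.
Proof.
under eq_bigr do rewrite /pmf_X -mulr_suml.
by rewrite -mulr_suml divff// gt_eqF// total_weight_gt0.
Qed.

Lemma pmf_Y_sum1 : \sum_y pmf_Y A y = 1.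
Proof. by rewrite -pmf_X_sum1 exchange_big. Qed.

End marginals.

Theorem theorem2p1 (R : realType) (n : nat) (n_ge2 : (2 <= n.+1)%N)
  (A : 'M[R]_n.+1)
  (A_ge0 : forall x y, 0 <= A x y)
  (row_gt0 : forall x, 0 < \sum_y A x y)
  (col_gt0 : forall y, 0 < \sum_x A x y)
  (d : measure_display) (Omega : measurableType d) (P : probability Omega R)
  (X Y : {RV P >-> 'I_n.+1})
  (XY_joint : forall x y,
     P [set w | X w = x /\ Y w = y] = (joint_pmf A x y)%:E) :
  let mu := @lebesgue_measure R in
  let I : set R := `[0, 1]%classic in
  let C := graph_copula A P X Y in
  [/\ forall u v, I u -> I v -> 0 <= C u v,
      measurable_fun (I `*` I) (fun w : R * R => C w.1 w.2),
      (mu \x mu)%E.-integrable (I `*` I)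
        (fun w : R * R => (C w.1 w.2 ^+ 2)%:E) &
      forall j k : nat, (1 <= j <= n)%N -> (1 <= k <= n)%N ->
        LP A P X Y j k =
          (\sum_x \sum_y
             joint_pmf A x y * T_X A P X j x * T_Y A P Y k y)%:E /\
        LP A P X Y j k =
          (\int[mu]_(u in I) ((S_X A P X j u)%:E *
             \int[mu]_(v in I) (C u v * S_Y A P Y k v)%:E))%E].
Proof.
move=> mu I C.
have pX := pmf_X_gt0 row_gt0; have pY := pmf_Y_gt0 row_gt0 col_gt0.
have pX0 x : 0 <= pmf_X A x by exact: ltW.
have pY0 y : 0 <= pmf_Y A y by exact: ltW.
have sumX := pmf_X_sum1 row_gt0; have sumY := pmf_Y_sum1 row_gt0.
have FX := distr_fun_X XY_joint; have FY := distr_fun_Y XY_joint.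
pose qX := quantile (distr_fun P X); pose qY := quantile (distr_fun P Y).
pose c x y := joint_pmf A x y / (pmf_X A x * pmf_Y A y).
(* The cells of the pair of quantile functions are rectangles, products of cells of each; the copula
   density is constant on each rectangle. *)
have mcell (z : 'I_n.+1 * 'I_n.+1) : measurable
    ((I `*` I) `&` (fun w : R * R => (qX w.1, qY w.2)) @^-1` [set z]).
  rewrite (_ : _ `&` _ =
    (I `&` qX @^-1` [set z.1]) `*` (I `&` qY @^-1` [set z.2])).
    apply: measurableX; first exact: measurable_quantile_cell FX _.
    exact: measurable_quantile_cell FY _.
  case: z => x y; apply/seteqP; split=> [[u v] /= [[Iu Iv] [<- <-]]//|[u v]].
  by move=> /= [[Iu <-] [Iv <-]].
split.
- move=> u v _ _; apply: divr_ge0; last exact: mulr_ge0.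
  by rewrite divr_ge0// ltW// total_weight_gt0.
- exact: (measurable_fun_finite_range mcell (fun z => c z.1 z.2)).
(* Square integrability: finitely many values on a square of measure 1. *)
- apply: (integrable_finite_range (mu := (mu \x mu)%E) mcell
    (fun z => c z.1 z.2 ^+ 2)).
  have muII : (mu \x mu)%E (I `*` I) = (mu I * mu I)%E.
    by apply: product_measure1E; exact: measurable_itv.
  rewrite [X in (X < _)%E]muII /mu /I lebesgue_measure_itv/=.
  by rewrite lte_fin ltr01 -EFinB -EFinM ltry.
move=> j k _ _.
have LPE : LP A P X Y j k =
    (\sum_x \sum_y joint_pmf A x y * T_X A P X j x * T_Y A P Y k y)%:E.
  rewrite /LP expectation.unlock.
  rewrite (integral_joint XY_joint (fun x y => T_X A P X j x * T_Y A P Y k y)).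
  congr EFin; apply: eq_bigr => x _; apply: eq_bigr => y _.
  by rewrite mulrC mulrA.
split=> //; rewrite LPE.
(* For fixed [u] the inner integral is a sum over [y] depending on [u] only through [qX u], so the
   quantile transform applies again to the outer one. *)
under eq_integral => u _ do
  rewrite (integral_quantile pY0 sumY FY (fun y => c (qX u) y * T_Y A P Y k y)).
rewrite (integral_quantile pX0 sumX FX (fun x =>
  T_X A P X j x * \sum_y c x y * T_Y A P Y k y * pmf_Y A y)).
congr EFin; apply: eq_bigr => x _.
rewrite mulr_sumr mulr_suml; apply: eq_bigr => y _.
(* Positive marginals let the two cell lengths cancel the denominator of [c x y]. *)
have := pX x; have := pY y => /lt0r_neq0 y0 /lt0r_neq0 x0.
by rewrite /c; field; rewrite x0 y0.
Qed.
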